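(* Let $G$ be a finite non-solvable group. Then the intersection of all non-nilpotent maximal subgroups $M$ of $G$ such that $N_G(P)\leq M$ for some Sylow subgroup $P$ of $G$ is nilpotent.
   Context: All groups are finite. A Sylow subgroup of $G$ means a Sylow $p$-subgroup of $G$ for some prime $p$ dividing $|G|$; the prime and the Sylow subgroup $P$ may depend on the maximal subgroup $M$. $N_G(P)$ denotes the normalizer of $P$ in $G$. A maximal subgroup is a maximal proper subgroup; ''non-nilpotent maximal subgroup'' means a maximal subgroup that is not nilpotent as a group. *)

(* Defs.v *)
From HB Require Import structures.
From mathcomp Require Import all_boot all_fingroup all_solvable.

Set Implicit Arguments.
Unset Strict Implicit.
Unset Printing Implicit Defensive.

Local Open Scope group_scope.

(* [Sylow G P] of sylow.v also accepts the trivial group, so the prime is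
   taken explicitly among the prime divisors of #|G|. *)
Definition contains_Sylow_normalizer (gT : finGroupType) (G M : {set gT}) :=
  [exists P : {group gT},
     has (fun p => p.-Sylow(G) P) (primes #|G|) && ('N_G(P) \subset M)].

(* As for any intersection of subgroups of G, the empty family yields G:
   without [G :&: _], [\bigcap] over an empty family would be [set: gT]. *)
Definition nonnil_max_Sylow_normalizer_core (gT : finGroupType)
    (G : {set gT}) : {set gT} :=
  G :&: \bigcap_(M : {group gT} |
           [&& maximal M G, ~~ nilpotent M & contains_Sylow_normalizer G M]) M.

(* Main.v *)
Require Import Defs.
From HB Require Import structures.
From mathcomp Require Import all_boot all_fingroup all_solvable.
From mathcomp Require Import ssralg zmodp mxrepresentation mxabelem.

(** Let D be the intersection in question, a normal subgroup of G, and suppose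
that it is not nilpotent.  Let P be a Sylow p-subgroup of D that is not normal
in D, and let M be a maximal subgroup of G containing 'N_G(P).  The Frattini
argument gives G = D * 'N_G(P), so M does not contain D; but 'N_G(P) contains
the normalizer of some Sylow p-subgroup of G, so M would be one of the subgroups
intersected if it were not nilpotent.  Hence M is nilpotent
(core_Sylow_nilpotent_max).  In particular G / D, a quotient of 'N_G(P), is
nilpotent.

A nilpotent maximal subgroup M that contains a Sylow p-subgroup Q of G controls
the p-local structure of G: in G / 'O_p(G), the normalizer of a nontrivial
characteristic subgroup of Q / 'O_p(G) is M / 'O_p(G), which is nilpotent
(nilpotent_max_char_locals).  For odd p, Thompson's normal p-complement
theorem then makes G / 'O_p(G) p-nilpotent.

As G is not solvable it has a nontrivial perfect subgroup H, and H lies in every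
normal subgroup with solvable quotient.  So H is contained in D, and, for an odd
p as above, in the preimage of 'O_p^'(G / 'O_p(G)), whose Sylow p-subgroup
'O_p(G) is normal.  For every odd prime the Sylow subgroup of H is therefore
normal in H, either because the one of D is normal in D or by the previous
sentence.  Thus H / 'F(H) is a 2-group and H is solvable: a contradiction.  Thompson's
theorem says nothing about the prime 2, but leaving out one prime is harmless
here because groups of prime power order are solvable.

Most of the file proves Thompson's theorem.  The fusion part is Frobenius'
criterion (Frobenius_normal_p_complement), obtained from the transfer.  In a
minimal counterexample to Thompson's theorem G = U * Q * P1 with U = 'O_p(G)
self-centralizing, Q an abelian p'-group and U * P1 a Sylow subgroup.  If the
Thompson subgroup J of U * P1 is contained in U it is characteristic in U, hence
normal in G, which contradicts the hypothesis on 'N_G(J).  Otherwise an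
elementary abelian subgroup of maximal order is not contained in U and acts on
V = 'Ohm_1('Z(U)) as an offender: it centralizes a subgroup of V of index at
most the order of the group that it induces.  Passing to the centralizer in V of
a suitable subgroup of index p reduces this to the action of a p-group and a
p'-group normalized by it on a group of order at most p ^ 2, where it is refuted
by counting (offender_cent, coprime_plane). *)

Set Implicit Arguments.
Unset Strict Implicit.
Unset Printing Implicit Defensive.

Local Open Scope group_scope.

(** * p-nilpotent groups *)

Definition pnilpotent (p : nat) (gT : finGroupType) (A : {set gT}) :=
  p.-group (A / 'O_p^'(A)).

Section PNilpotent.

Variable p : nat.
Implicit Types gT rT : finGroupType.

Lemma pnilpotent_ext gT (G K : {group gT}) :
  K <| G -> p^'.-group K -> p.-group (G / K) -> pnilpotent p G.
Proof.
move=> nsKG p'K pGK; have sKO: K \subset 'O_p^'(G) by rewrite pcore_max.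
rewrite /pnilpotent -(isog_pgroup _ (third_isog sKO nsKG (pcore_normal _ _))).
exact: quotient_pgroup.
Qed.

Lemma pnilpotent_pgroup gT (G : {group gT}) : p.-group G -> pnilpotent p G.
Proof. exact: quotient_pgroup. Qed.

Lemma pnilpotentS gT (G H : {group gT}) :
  H \subset G -> pnilpotent p G -> pnilpotent p H.
Proof.
move=> sHG pG; have nOH := subset_trans sHG (normal_norm (pcore_normal p^' G)).
apply: (@pnilpotent_ext _ _ ('O_p^'(G) :&: H)%G).
- by rewrite /normal subsetIr normsI ?normG.
- exact: pgroupS (subsetIl _ _) (pcore_pgroup _ _).
rewrite (isog_pgroup _ (second_isog nOH)); exact: pgroupS (quotientS _ sHG) pG.
Qed.

Lemma pnilpotent_morphim gT rT (D G : {group gT}) (f : {morphism D >-> rT}) :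
  pnilpotent p G -> pnilpotent p (f @* G).
Proof.
move=> /(pnilpotentS (subsetIr D G)) pG; rewrite -morphimIdom.
apply: (@pnilpotent_ext _ _ (f @* 'O_p^'(D :&: G))%G).
- exact: morphim_normal (pcore_normal _ _).
- exact: morphim_pgroup (pcore_pgroup _ _).
rewrite /pnilpotent /pgroup card_quotient ?gFnorm // in pG.
rewrite /pgroup card_quotient ?morphim_norms ?gFnorm //.
by apply: pnat_dvd pG; rewrite index_morphim // subIset ?subsetIl.
Qed.

Lemma pnilpotent_quo gT (G H : {group gT}) :
  pnilpotent p G -> pnilpotent p (G / H).
Proof. exact: pnilpotent_morphim. Qed.

Lemma pnilpotent_quo_p' gT (G H : {group gT}) :
  H <| G -> p^'.-group H -> pnilpotent p (G / H) -> pnilpotent p G.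
Proof.
move=> nsHG p'H pGH.
have [K defK sHK nsKG] := inv_quotientN nsHG (pcore_normal p^' (G / H)).
apply: (@pnilpotent_ext _ _ K) => //.
  have nHK := subset_trans (normal_sub nsKG) (normal_norm nsHG).
  by rewrite -(pquotient_pgroup p'H nHK) -defK pcore_pgroup.
by rewrite -(isog_pgroup _ (third_isog sHK nsHG nsKG)) -defK.
Qed.

Lemma pnilpotent_quo_p gT (G N : {group gT}) :
  N <| G -> p.-group (G / N) -> pnilpotent p N -> pnilpotent p G.
Proof.
move=> nsNG pGN pN.
have nsKG : 'O_p^'(N) <| G by apply: gFnormal_trans.
apply: (@pnilpotent_ext _ _ 'O_p^'(N)%G) => //; first exact: pcore_pgroup.
rewrite /pgroup card_quotient ?normal_norm //.
rewrite -(Lagrange_index (normal_sub nsNG) (pcore_sub _ _)) pnatM.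
rewrite -!card_quotient ?gFnorm ?normal_norm //; exact/andP.
Qed.

Lemma nilpotent_pnilpotent gT (G : {group gT}) :
  nilpotent G -> pnilpotent p G.
Proof.
move=> nilG; have hallO := nilpotent_pcore_Hall p^' nilG.
rewrite /pnilpotent /pgroup card_quotient ?gFnorm //.
by have /and3P[_ _] := hallO; rewrite pnatNK.
Qed.

(** Both are normal in G and their orders are coprime, so they commute. *)
Lemma p'core_cent_pgroup gT (G U : {group gT}) :
  U <| G -> p.-group U -> 'O_p^'(G) \subset 'C(U).
Proof.
move=> nsUG pU; apply/commG1P/trivgP.
have <- : 'O_p^'(G) :&: U = 1.
  by rewrite setIC; apply: coprime_TIg (pnat_coprime pU (pcore_pgroup _ _)).
rewrite commg_subI // subsetI subxx.
  exact: subset_trans (pcore_sub _ _) (normal_norm nsUG).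
exact: subset_trans (normal_sub nsUG) (gFnorm _ _).
Qed.

Lemma normal_pquo_mul_Sylow gT (G N P : {group gT}) :
  N <| G -> p.-group (G / N) -> p.-Sylow(G) P -> N * P = G.
Proof.
move=> nsNG pGN sylP; have [sNG nNG] := andP nsNG.
have [sPG pP _] := and3P sylP; have nNP := subset_trans sPG nNG.
have defGN : P / N = G / N := pHall_id (quotient_pHall nNP sylP) pGN.
by rewrite -quotientK // defGN quotientGK.
Qed.

Lemma pnilpotent_mul_Sylow gT (G P : {group gT}) :
  pnilpotent p G -> p.-Sylow(G) P -> 'O_p^'(G) * P = G.
Proof. exact: normal_pquo_mul_Sylow (pcore_normal _ _). Qed.

Lemma quotient_Sylow_lift gT (G K : {group gT}) (S : {group coset_of K}) :
    K <| G -> p.-Sylow(G / K) S ->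
  exists2 P : {group gT}, p.-Sylow(G) P & S :=: P / K.
Proof.
move=> nsKG sylS; have [P sylP] := Sylow_exists p G.
have nKP := subset_trans (pHall_sub sylP) (normal_norm nsKG).
have sylPK := quotient_pHall nKP sylP.
have [_ /morphimP[x Nx Gx ->] defS] := Sylow_trans sylPK sylS.
by exists (P :^ x)%G; rewrite ?pHallJ //= defS quotientJ.
Qed.

Lemma pnilpotent_p'core1 gT (G : {group gT}) :
  pnilpotent p G -> 'O_p^'(G) = 1 -> p.-group G.
Proof.
rewrite /pnilpotent => pG O1; move: pG.
by rewrite O1 -(isog_pgroup _ (quotient1_isog G)).
Qed.

End PNilpotent.

(** * Frobenius' normal p-complement theorem *)

Section Frobenius.

Import GRing.Theory FiniteModule.
Variable p : nat.

(** Two Sylow subgroups are conjugate by an element that centralizes their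
intersection D.  In 'N_G(D) the p'-core centralizes D and is transitive on Sylow
subgroups, so P and Q can be linked through Sylow subgroups that meet their
neighbours in more than D; the induction is on the index of D. *)
Lemma p'local_Sylow_cent (gT : finGroupType) (G P Q : {group gT}) :
    (forall U : {group gT}, U \subset G -> p.-group U -> U :!=: 1 ->
       pnilpotent p 'N_G(U)) ->
    p.-Sylow(G) P -> p.-Sylow(G) Q ->
  exists2 c, c \in 'C_G(P :&: Q) & Q :^ c = P.
Proof.
move=> locG; have [n] := ubnP (#|P| - #|P :&: Q|).
elim: n => // n IHn in P Q *; rewrite ltnS => ltPQn sylP sylQ.
have [sPG pP _] := and3P sylP; have [sQG pQ _] := and3P sylQ.
have [D1 | ntD] := eqVneq (P :&: Q) 1.
  have [x Gx defP] := Sylow_trans sylQ sylP; exists x; last by rewrite defP.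
  by rewrite inE Gx D1 -sub1set cents1.
have [ePQ | neqPQ] := eqVneq (P :&: Q) P.
  exists 1; rewrite ?group1 // conjsg1; apply/eqP.
  rewrite eq_sym eqEcard -{1}ePQ subsetIr.
  by rewrite (card_Hall sylP) (card_Hall sylQ) /=.
set D := (P :&: Q)%G; have sDP : D \subset P := subsetIl _ _.
have sDQ : D \subset Q := subsetIr _ _.
have prDP : D \proper P by rewrite properEneq neqPQ.
have cardPQ : #|P| = #|Q| by rewrite (card_Hall sylP) (card_Hall sylQ).
have prDQ : D \proper Q by rewrite properEcard sDQ -cardPQ proper_card.
have pN := locG D (subset_trans sDP sPG) (pgroupS sDP pP) ntD.
have prP := nilpotent_proper_norm (pgroup_nil pP) prDP.
have prQ := nilpotent_proper_norm (pgroup_nil pQ) prDQ.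
have [S sylS sPS] : {S : {group gT} | p.-Sylow('N_G(D)) S & 'N_P(D) \subset S}.
  by apply: Sylow_superset; rewrite ?setSI // (pgroupS (subsetIl _ _) pP).
have [T sylT sQT] : {T : {group gT} | p.-Sylow('N_G(D)) T & 'N_Q(D) \subset T}.
  by apply: Sylow_superset; rewrite ?setSI // (pgroupS (subsetIl _ _) pQ).
have nsDN : D <| 'N_G(D) by rewrite normalSG // (subset_trans sDP).
have cDO : 'O_p^'('N_G(D)) \subset 'C(D).
  exact: p'core_cent_pgroup nsDN (pgroupS sDP pP).
have [x Nx defS] := Sylow_trans sylT sylS.
have [c Oc defSc] : exists2 c, c \in 'O_p^'('N_G(D)) & S :=: T :^ c.
  move: Nx; rewrite -(pnilpotent_mul_Sylow pN sylT) -normC; last first.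
    by rewrite (subset_trans (pHall_sub sylT)) ?gFnorm.
  case/mulsgP=> t c Tt Oc def_x; exists c => //.
  by rewrite defS def_x conjsgM conjGid.
have Cc : c \in 'C_G(D).
  rewrite inE (subsetP cDO) // andbT.
  by have /setIP[] := subsetP (pcore_sub _ _) _ Oc.
have [Gc _] := setIP Cc.
have [R sylR sSR] : {R : {group gT} | p.-Sylow(G) R & S \subset R}.
  apply: Sylow_superset; first exact: subset_trans (pHall_sub sylS) (subsetIl _ _).
  exact: pHall_pgroup sylS.
(* The intersection grows because normalizers grow in p-groups. *)
have step (P1 R1 : {group gT}) : p.-Sylow(G) P1 -> p.-Sylow(G) R1 ->
    D \proper 'N_P1(D) -> 'N_P1(D) \subset R1 ->
  exists2 y, y \in 'C_G(D) & R1 :^ y = P1.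
- move=> sylP1 sylR1 prD sNR; have sNI : 'N_P1(D) \subset P1 :&: R1.
    by rewrite subsetI subsetIl.
  have [|y Cy defP1] := IHn P1 R1 _ sylP1 sylR1.
    apply: leq_trans ltPQn; rewrite (card_Hall sylP1) -(card_Hall sylP).
    rewrite ltn_sub2l ?proper_card // (proper_sub_trans prD) //.
  exists y => //; apply: subsetP Cy; rewrite setIS // centS //.
  exact: subset_trans (proper_sub prD) sNI.
have [y Cy defP] := step P R sylP sylR prP (subset_trans sPS sSR).
have [z Cz defQ] : exists2 z, z \in 'C_G(D) & (R :^ c^-1) :^ z = Q.
  apply: (step Q (R :^ c^-1)%G) => //; first by rewrite pHallJ ?groupV.
  by rewrite (subset_trans sQT) // -sub_conjg -defSc.
exists (z^-1 * c * y); first by rewrite !groupM ?groupV.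
by rewrite -defQ !conjsgM conjsgK conjsgKV.
Qed.

(** P controls its own fusion: if x and x ^ g lie in P then x lies in both P and
P :^ g^-1, and by p'local_Sylow_cent an element centralizing x moves one to the
other; so g can be replaced by an element of 'N_G(P), and then, as 'N_G(P) is
p-nilpotent, by an element of P. *)
Lemma p'local_fusion (gT : finGroupType) (G P : {group gT}) x g :
    (forall U : {group gT}, U \subset G -> p.-group U -> U :!=: 1 ->
       pnilpotent p 'N_G(U)) ->
    p.-Sylow(G) P -> x \in P -> g \in G -> x ^ g \in P ->
  exists2 u, u \in P & x ^ g = x ^ u.
Proof.
move=> locG sylP Px Gg Pxg; have [sPG pP _] := and3P sylP.
have [P1 | ntP] := eqVneq P 1%G.
  exists 1; first exact: group1.
  by move: Px; rewrite P1 => /set1P->; rewrite !conj1g.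
have [|c] := p'local_Sylow_cent locG sylP (_ : p.-Sylow(G) (P :^ g^-1)%G).
  by rewrite pHallJ ?groupV.
case/setIP=> Gc Cc defP; set n := g^-1 * c.
have Nn : n \in 'N_G(P) by rewrite !inE !groupM ?groupV //= conjsgM defP.
have xc : x ^ c = x.
  apply/conjg_fixP/commgP; apply: commute_sym; apply: (centP Cc).
  by rewrite inE Px mem_conjgV.
have xg : x ^ g = x ^ n^-1 by rewrite invMg invgK conjgM -{2}xc conjgK.
have pN := locG P sPG pP ntP.
have nsPN : P <| 'N_G(P) by rewrite normalSG.
have sylPN : p.-Sylow('N_G(P)) P by rewrite Sylow_subnorm.
move: (groupVr Nn); rewrite -(pnilpotent_mul_Sylow pN sylPN).
case/mulsgP=> k u Ok Pu def_n; exists u => //; rewrite xg def_n conjgM.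
congr (_ ^ _); apply/conjg_fixP/commgP; apply: commute_sym.
by apply: (centP (subsetP (p'core_cent_pgroup nsPN pP) _ Ok)).
Qed.

(** The transfer to S / S^`(1) restricts to S as the #|G : S|-th power map,
because fusion in S is controlled by S.  Its kernel N therefore meets S in
S^`(1), which is proper in S. *)
Lemma fusion_control_normal_p (gT : finGroupType) (G S : {group gT}) :
    p.-Sylow(G) S -> S :!=: 1 ->
    (forall x g, x \in S -> g \in G -> x ^ g \in S ->
       exists2 u, u \in S & x ^ g = x ^ u) ->
  exists N : {group gT}, [/\ N <| G, N \proper G & p.-group (G / N)].
Proof.
move=> sylS ntS fusS; have [sSG pS p'iSG] := and3P sylS.
pose alpha := restrm_morphism (der_norm 1 S) (coset_morphism S^`(1)).
have im_alpha : alpha @* S = S / S^`(1) by rewrite morphim_restrm setIid.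
have abelS : abelian (alpha @* S) by rewrite im_alpha der_abelian.
pose tau := transfer_morphism G abelS; exists ('ker tau)%G.
have pT : p.-group [set: fmod_of abelS].
  have -> : [set: fmod_of abelS] = fmod_morphism abelS @* (alpha @* S).
    apply/eqP; rewrite eqEsubset subsetT andbT; apply/subsetP=> u _.
    by rewrite -(fmvalK u) mem_morphim // fmodP.
  by rewrite !morphim_pgroup.
split; first exact: ker_normal.
  rewrite properE subsetIl /=; apply/negP=> sGN.
  have: S^`(1) \proper S by rewrite (sol_der1_proper (pgroup_sol pS)).
  rewrite properE => /andP[_ /negP[]]; apply/subsetP=> g Sg.
  have Gg := subsetP sSG g Sg.
  have trX := transversalP (rcosets_cycle_partition sSG Gg).
  set X := transversal _ _ in trX; have sXG := subsetP (transversal_sub trX).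
  have tau_g : (fmod abelS (alpha g) *+ #|G : S| = 0)%R.
    have <- : tau g = 0%R by apply/kerP => //; apply: subsetP Gg.
    rewrite [tau g](transfer_cycle_expansion sSG abelS Gg trX).
    rewrite -(sum_index_rcosets_cycle sSG Gg trX) -sumrMnr.
    apply: eq_bigr => x Xx.
    set n := #|_ : _|; rewrite /= /restrm /=.
    have Sgn := groupX n Sg.
    have Sgnx : (g ^+ n) ^ x^-1 \in S.
      by rewrite conjgE invgK mulgA -mem_rcoset mulg_exp_card_rcosets.
    have [u Su ->] := fusS _ _ Sgn (groupVr (sXG x Xx)) Sgnx.
    rewrite -[RHS]/(fmod abelS (alpha _)) morphJ // morphX //.
    have -> : (alpha g ^+ n) ^ alpha u = alpha g ^+ n.
      apply/conjg_fixP/commgP; apply: (centsP abelS); last exact: mem_morphim.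
      by rewrite groupX ?mem_morphim.
    by rewrite fmodX ?mem_morphim.
  have Ag : alpha g \in alpha @* S by rewrite mem_morphim.
  have alpha_g : alpha g ^+ #|G : S| = 1.
    by have := congr_fmod tau_g; rewrite -fmodX // fmodK ?groupX.
  have {alpha_g} : alpha g = 1.
    have dvd_g : #[alpha g] %| #|G : S| by rewrite order_dvdn alpha_g.
    apply/eqP; rewrite -order_eq1 -(gcdn_idPl dvd_g).
    apply: pnat_coprime p'iSG; apply: mem_p_elt Ag.
    by rewrite morphim_pgroup.
  move/coset_idr; apply; exact: subsetP (der_norm 1 S) _ Sg.
by rewrite (isog_pgroup _ (first_isog tau)); apply: pgroupS (subsetT _) pT.
Qed.

(** Both the hypothesis and p-nilpotence pass through the normal subgroup of
p-power index that transfer provides, so induction on the order applies. *)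
Theorem Frobenius_normal_p_complement (gT : finGroupType) (G : {group gT}) :
    (forall U : {group gT}, U \subset G -> p.-group U -> U :!=: 1 ->
       pnilpotent p 'N_G(U)) ->
  pnilpotent p G.
Proof.
have [n] := ubnP #|G|; elim: n G => // n IHn G /ltnSE-leGn locG.
have [S sylS] := Sylow_exists p G; have [sSG pS _] := and3P sylS.
have [S1 | ntS] := eqVneq S 1%G.
  apply: (@pnilpotent_ext _ _ _ G) => //; last by rewrite trivg_quotient pgroup1.
  by rewrite -partG_eq1 -(card_Hall sylS) S1 cards1.
have [|N [nsNG prNG pGN]] := fusion_control_normal_p sylS ntS.
  by move=> x g Sx Gg Sxg; apply: p'local_fusion locG sylS Sx Gg Sxg.
have sNG := normal_sub nsNG.
apply: pnilpotent_quo_p nsNG pGN _; apply: IHn => [|U sUN pU ntU].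
  exact: leq_trans (proper_card prNG) leGn.
by apply: pnilpotentS (locG U _ pU ntU); rewrite ?setSI ?(subset_trans sUN).
Qed.

End Frobenius.

(** * Coprime action on small p-groups *)

Section CoprimeAction.

Implicit Types gT : finGroupType.

Lemma coprime_comm_mul_cent gT (A G : {group gT}) :
    A \subset 'N(G) -> coprime #|G| #|A| -> solvable G ->
  [~: G, A] * 'C_G(A) = G.
Proof.
move=> nGA coGA solG; have sRG : [~: G, A] \subset G by rewrite commg_subl.
have nRG : G \subset 'N([~: G, A]) := commg_norml G A.
have nRA : A \subset 'N([~: G, A]) := commg_normr A G.
rewrite -quotientK ?subIset ?nRG // coprime_quotient_cent //.
rewrite (setIidPl _) ?quotient_cents2r //.
by rewrite quotientGK // /normal sRG.
Qed.

Lemma coprime_stable_factor_cent gT (A G N : {group gT}) :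
    A \subset 'N(G) -> coprime #|G| #|A| -> solvable G ->
    A \subset 'C(N) -> [~: G, A] \subset N -> A \subset 'C(G).
Proof.
move=> nGA coGA solG cNA sRN; rewrite centsC.
rewrite -{1}(coprime_comm_mul_cent nGA coGA solG) mul_subG ?subsetIr //.
by rewrite (subset_trans sRN) // centsC.
Qed.

Lemma pgroup_cent_neq1 gT (p : nat) (A W : {group gT}) :
  p.-group A -> p.-group W -> A \subset 'N(W) -> W :!=: 1 -> 'C_W(A) != 1.
Proof.
move=> pA pW nWA ntW; have nsW : W <| W <*> A.
  by rewrite /normal joing_subl join_subG normG.
have pWA : p.-group (W <*> A) by rewrite norm_joinEr // pgroupM pW.
have := meet_center_nil (pgroup_nil pWA) nsW ntW.
apply: contraNneq => CW1; rewrite -subG1 -CW1 setIS // subIset // orbC.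
by rewrite centS ?joing_subr.
Qed.

Lemma pgroup_leq_p2_abelian gT (p : nat) (W : {group gT}) :
  prime p -> p.-group W -> #|W| <= p ^ 2 -> abelian W.
Proof.
move=> p_pr pW leW; apply: (p2group_abelian pW).
by rewrite -(leq_exp2l _ _ (prime_gt1 p_pr)) -card_pgroup.
Qed.

Lemma commg_neq1_exists gT (A Q : {group gT}) (y : gT) :
  y \in Q -> y != 1 -> 'C_Q(A) = 1 -> exists2 a, a \in A & [~ a, y] != 1.
Proof.
move=> Qy nty CQA.
apply/exists_inP; apply: contraNT nty; rewrite negb_exists_in.
move/forall_inP=> cAy; apply/eqP/set1gP; rewrite -CQA inE Qy; apply/centP=> a Aa.
by apply/commute_sym/commgP; apply: contraTT (cAy a Aa); rewrite negbK.
Qed.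

(** A common fixed point w <> 1 would be fixed by the nontrivial p'-element
[~ a, y], which also acts trivially on W / <[w]>, as A and A :^ y do: that
quotient has order at most p.  By coprime action [~ a, y] would centralize W. *)
Lemma plane_TI gT (p : nat) (A Q W : {group gT}) (y : gT) :
    prime p -> p.-group A -> p^'.-group Q -> p.-group W ->
    #|W| <= p ^ 2 -> A \subset 'N(Q) -> A \subset 'N(W) -> Q \subset 'N(W) ->
    'C_Q(A) = 1 -> 'C_Q(W) = 1 -> y \in Q -> y != 1 ->
  'C_W(A) :&: 'C_W(A) :^ y = 1.
Proof.
move=> p_pr pA p'Q pW leW nQA nWA nWQ CQA CQW Qy nty.
apply/trivgP/subsetP=> w /setIP[/setIP[Ww CAw]]; rewrite mem_conjg.
case/setIP=> _ CAwy; apply/set1P; apply/eqP/idPn=> ntw.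
have cwA : A \subset 'C[w] by rewrite sub_cent1.
have cwAy : A :^ y \subset 'C[w].
  by rewrite sub_cent1 centJ mem_conjg.
pose N := <[w]>%G; have sNW : N \subset W by rewrite cycle_subG.
have nNAy z : A :^ z \subset 'C[w] -> A :^ z \subset 'N(N).
  by move=> cw; rewrite cents_norm // cent_cycle.
have abW : abelian W := pgroup_leq_p2_abelian p_pr pW leW.
have nNW : W \subset 'N(N) by rewrite cents_norm // centsC (subset_trans sNW).
have cWN z : z \in 'N(W) -> A :^ z \subset 'C[w] -> A :^ z / N \subset 'C(W / N).
  move=> Nz cw; set B := (A :^ z)%G; have pB : p.-group B by rewrite pgroupJ.
  have nWB : B \subset 'N(W) by rewrite -(normP Nz) normJ conjSg.
  have [W1 | ntWN] := eqVneq (W / N) 1; first by rewrite W1 cents1.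
  have pWN : p.-group (W / N) by rewrite quotient_pgroup.
  have := pgroup_cent_neq1 (quotient_pgroup N pB) pWN (quotient_norms N nWB) ntWN.
  have prWN : #|W / N| = p.
    have ntN : N :!=: 1 by rewrite cycle_eq1.
    have [_ p_dvN _] := pgroup_pdiv (pgroupS sNW pW) ntN.
    have [_ p_dvWN _] := pgroup_pdiv pWN ntWN.
    apply/eqP; rewrite eqn_leq (dvdn_leq _ p_dvWN) // andbT.
    rewrite -(leq_pmul2r (prime_gt0 p_pr)) mulnn; apply: leq_trans leW.
    rewrite -(Lagrange sNW) mulnC -card_quotient //.
    by rewrite leq_mul2r dvdn_leq ?orbT.
  move=> ntC; rewrite centsC; apply/setIidPl/eqP; rewrite eqEcard subsetIl /=.
  rewrite prWN; apply: dvdn_leq => //.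
  by have [] := pgroup_pdiv (pgroupS (subsetIl _ _) pWN) ntC.
have [a Aa ntay] := commg_neq1_exists Qy nty CQA.
set s := [~ a, y] in ntay; have Qs : s \in Q.
  by rewrite /s commgEr groupM // memJ_norm ?groupV // (subsetP nQA).
have cW1 := cWN 1 (group1 _); have cWy := cWN y (subsetP nWQ y Qy).
rewrite conjsg1 in cW1.
have Aya : a ^ y \in A :^ y by rewrite memJ_conjg.
have cws : <[s]> \subset 'C(N).
  rewrite cycle_subG /= cent_cycle /s commgEl groupM ?groupV //.
    exact: (subsetP cwA).
  exact: (subsetP cwAy).
have nNA : A \subset 'N(N) by have := nNAy 1; rewrite conjsg1; apply.
case/negP: ntay; apply/eqP/set1gP; rewrite -CQW inE Qs -cycle_subG.
rewrite /=; apply: (coprime_stable_factor_cent (N := N)) => //.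
- by rewrite cycle_subG (subsetP nWQ).
- exact: pnat_coprime pW (mem_p_elt p'Q Qs).
- exact: pgroup_sol pW.
have nNs : <[s]> \subset 'N(N) by rewrite cents_norm.
rewrite -quotient_cents2 // centsC quotient_cycle; last first.
  by rewrite -cycle_subG.
have Na : a \in 'N(N) := subsetP nNA a Aa.
have Nay : a ^ y \in 'N(N) := subsetP (nNAy y cwAy) _ Aya.
rewrite cycle_subG /s commgEl morphM ?groupV // morphV // groupM //.
  by rewrite groupV (subsetP (cW1 cwA)) ?mem_quotient.
by rewrite (subsetP (cWy cwAy)) ?mem_quotient.
Qed.

(** This is where p = 2 must be excluded.  By plane_TI the sets 'C_W(A)^# :^ y, for
y in Q, are disjoint subsets of W^#; each has at least p - 1 elements.  As
#|Q| = 1 modulo p, a nontrivial Q has at least p + 1 elements, so they are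
exactly p + 1 in number and cover W^#.  Then #|Q| is even.  An involution t
of Q has no fixed point in W^#, since fixed points would lie in two of these
sets, so it inverts W and maps 'C_W(A) to itself: again a contradiction. *)
Lemma coprime_plane gT (p : nat) (A Q W : {group gT}) :
    prime p -> odd p -> p.-group A -> p^'.-group Q -> p.-group W ->
    #|W| <= p ^ 2 -> A \subset 'N(Q) -> A \subset 'N(W) -> Q \subset 'N(W) ->
    'C_Q(A) = 1 -> 'C_Q(W) = 1 -> Q :=: 1.
Proof.
move=> p_pr odd_p pA p'Q pW leW nQA nWA nWQ CQA CQW.
apply/eqP/idPn=> ntQ.
have TI y : y \in Q -> y != 1 -> 'C_W(A) :&: 'C_W(A) :^ y = 1.
  exact: (plane_TI p_pr pA p'Q pW).
have ntW : W :!=: 1.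
  by apply: contraNneq ntQ => W1; rewrite -CQW W1 (setIidPl (cents1 _)).
pose L := 'C_W(A)%G; have ntL : L :!=: 1 := pgroup_cent_neq1 pA pW nWA ntW.
have leL : p <= #|L|.
  have [_ p_dvL _] := pgroup_pdiv (pgroupS (subsetIl _ _) pW) ntL.
  exact: dvdn_leq.
have leQ : p.+1 <= #|Q|.
  have actQ : [acts A, on Q | 'J] by rewrite astabsJ.
  have /eqP := pgroup_fix_mod pA actQ; rewrite afixJ CQA cards1.
  rewrite eqn_mod_dvd ?cardG_gt0 // => /dvdn_leq.
  rewrite subn_gt0 cardG_gt1 ntQ => /(_ isT).
  by rewrite leq_subRL ?cardG_gt0 // add1n.
pose f (u : gT * gT) := u.2 ^ u.1; pose QL := setX Q L^#.
have inj_f : {in QL &, injective f}.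
  case=> y l [z m] /setXP[/= Qy /setD1P[ntl Ll]] /setXP[/= Qz /setD1P[ntm Lm]].
  rewrite /f /= => eq_lm; have [eq_yz | neq_yz] := eqVneq z y.
    by rewrite eq_yz in eq_lm *; rewrite (conjg_inj y eq_lm).
  have Qyz : z * y^-1 \in Q by rewrite groupM ?groupV.
  case/negP: ntl; apply/eqP/set1gP; rewrite -(TI _ Qyz) -?eq_mulgV1 //.
  by rewrite inE Ll mem_conjg invMg invgK conjgM eq_lm conjgK.
have sfW : f @: QL \subset W^#.
  apply/subsetP=> _ /imsetP[[y l] /setXP[/= Qy /setD1P[ntl /setIP[Wl _]]] ->].
  by rewrite /f /= !inE conjg_eq1 ntl memJ_norm // (subsetP nWQ).
have cardD1G (X : {group gT}) : #|X^#| = #|X|.-1.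
  by rewrite [in RHS](cardsD1 1) group1.
have cardQL : #|f @: QL| = (#|Q| * #|L|.-1)%N.
  by rewrite card_in_imset // cardsX cardD1G.
have p_gt1 := prime_gt1 p_pr; have := subset_leq_card sfW.
rewrite cardQL cardD1G => leQLW.
have [defQ defW] : #|Q| = p.+1 /\ #|W|.-1 = (#|Q| * #|L|.-1)%N.
  have leL1 : p.-1 <= #|L|.-1 by rewrite -!subn1 leq_sub2r.
  have defp : (p ^ 2).-1 = (p.+1 * p.-1)%N.
    by rewrite -subn1 -[in LHS](exp1n 2) subn_sqr subn1 addn1 mulnC.
  have leQp : #|Q| * p.-1 <= p.+1 * p.-1.
    rewrite -defp; apply: leq_trans (leq_mul (leqnn _) leL1) _.
    by apply: leq_trans leQLW _; rewrite -!subn1 leq_sub2r.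
  have p1_gt0 : 0 < p.-1 by rewrite -subn1 subn_gt0.
  have defQ : #|Q| = p.+1.
    by apply/eqP; rewrite eqn_leq leQ -(leq_pmul2r p1_gt0) leQp.
  split=> //; apply/eqP; rewrite eqn_leq leQLW andbT.
  apply: (@leq_trans (p ^ 2).-1); first by rewrite -!subn1 leq_sub2r.
  by rewrite defp defQ leq_mul.
have defWf : f @: QL = W^#.
  by apply/eqP; rewrite eqEcard sfW cardQL cardD1G defW /=.
have [t Qt ot] : {t | t \in Q & #[t] = 2}.
  by apply: Cauchy; rewrite // defQ dvdn2 /= odd_p.
have ntt : t != 1 by rewrite -order_eq1 ot.
have [l /setD1P[ntl Ll]] : exists l, l \in L^#.
  apply/set0Pn; rewrite -cards_eq0 -lt0n cardD1G -subn1 subn_gt0.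
  exact: leq_trans p_gt1 leL.
have [Wl CAl] := setIP Ll.
have abW : abelian W := pgroup_leq_p2_abelian p_pr pW leW.
have Wlt : l ^ t \in W by rewrite memJ_norm // (subsetP nWQ).
have ltt : (l ^ t) ^ t = l by rewrite -conjgM -expg2 -ot expg_order conjg1.
(* The product l * l ^ t is fixed by t. *)
have [u1 | ntu] := eqVneq (l * l ^ t) 1.
  case/negP: ntl; rewrite -eq_invg1; apply/eqP/set1gP; rewrite -(TI t Qt ntt).
  have lt : l ^ t = l^-1 by rewrite -[RHS]mulg1 -u1 mulKg.
  by rewrite inE groupV Ll -lt memJ_conjg.
have: l * l ^ t \in f @: QL by rewrite defWf !inE ntu groupM.
case/imsetP=> -[y m] QLm; rewrite /f /= => defu.
have [Qy Lm] := setXP QLm.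
have QLmt : (y * t, m) \in QL by apply/setXP; rewrite /= groupM.
have /(congr1 fst) /= eq_y : (y, m) = (y * t, m).
  apply: inj_f => //; rewrite /f /= conjgM -defu conjMg ltt.
  exact: (centsP abW).
by case/negP: ntt; rewrite -(inj_eq (mulgI y)) mulg1 -eq_y.
Qed.
End CoprimeAction.

(** * Offenders *)

Section Offender.

Implicit Types gT : finGroupType.

(** A case of Thompson's A x B lemma: otherwise [~: V, Y] would contain a
nontrivial fixed point of B, which Y centralizes by hypothesis, although
[~: V, Y] meets 'C_V(Y) trivially. *)
Lemma cent_cent_pgroup gT (p : nat) (B V Y : {group gT}) :
    p.-group B -> p.-group V -> abelian V -> p^'.-group Y ->
    B \subset 'N(V) -> Y \subset 'N(V) -> Y \subset 'C(B) ->
    Y \subset 'C('C_V(B)) -> Y \subset 'C(V).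
Proof.
move=> pB pV abV p'Y nVB nVY cBY cVBY.
have coVY : coprime #|V| #|Y| := pnat_coprime pV p'Y.
have sWV : [~: V, Y] \subset V by rewrite commg_subl.
have nWB : B \subset 'N([~: V, Y]).
  by rewrite normsR // cents_norm // centsC.
apply: contraT; rewrite centsC (sameP commG1P eqP) => ntW.
have := pgroup_cent_neq1 pB (pgroupS sWV pV) nWB ntW.
rewrite -subG1 -(coprime_abel_cent_TI nVY coVY abV) subsetI subsetIl /= centsC.
by rewrite (subset_trans cVBY) ?centS ?setSI.
Qed.

(** B is the kernel of A on a minimal A-invariant subgroup R of [~: Q, A]: as A / B
is abelian and acts faithfully and irreducibly on R, it is cyclic. *)
Lemma abelem_cent_index gT (p : nat) (A C Q : {group gT}) :
    abelian Q -> A \subset 'N(Q) -> coprime #|Q| #|A| ->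
    C <| A -> p.-abelem (A / C) -> C \subset 'C(Q) -> ~~ (A \subset 'C(Q)) ->
  exists B : {group gT},
    [/\ C \subset B, B <| A, #|A : B| = p & ~~ (A \subset 'C('C_Q(B)))].
Proof.
move=> abQ nQA coQA nsCA abAC cQC ncQA.
have ntQ0 : [~: Q, A] != 1 by rewrite -(sameP commG1P eqP) centsC.
have sQ0Q : [~: Q, A] \subset Q by rewrite commg_subl.
have [R minR sRQ0] : {R : {group gT} | minnormal R A & R \subset [~: Q, A]}.
  by apply: mingroup_exists; rewrite ntQ0 commg_normr.
have solQ0 := solvableS sQ0Q (abelian_sol abQ).
have [nRA ntR abR] := minnormal_solvable minR sRQ0 solQ0.
have sRQ := subset_trans sRQ0 sQ0Q.
have /is_abelemP[q q_pr abqR] := abR.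
have ncRA : ~~ (A \subset 'C(R)).
  apply: contra ntR => cRA; rewrite -subG1 -(coprime_abel_cent_TI nQA coQA abQ).
  by rewrite subsetI sRQ0 centsC.
have sCB : C \subset 'C_A(R).
  by rewrite subsetI normal_sub // (subset_trans cQC) ?centS.
have nsBA : 'C_A(R) <| A by rewrite /normal subsetIl normsI ?normG ?norms_cent.
exists 'C_A(R)%G; split=> //; last first.
  apply: contra ncRA => /subset_trans; apply; rewrite centS // subsetI sRQ.
  by rewrite centsC subsetIr.
have abAB : p.-abelem (A / 'C_A(R)).
  by rewrite -(isog_abelem (third_isog sCB nsCA nsBA)) quotient_abelem.
have ntAB : A / 'C_A(R) != 1.
  rewrite -subG1 quotient_sub1 ?normal_norm //.
  by apply: contra ncRA => /subset_trans; apply; apply: subsetIr.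
have cycAB : cyclic (A / 'C_A(R)).
  pose rR := abelem_repr abqR ntR nRA.
  have defK : rker rR = 'C_A(R) := rker_abelem abqR ntR nRA.
  have irrR : mx_irreducible rR by apply/abelem_mx_irrP.
  rewrite -defK; apply: (mx_faithful_irr_abelian_cyclic (kquo_mx_faithful rR)).
    exact/quo_mx_irr.
  by rewrite defK (abelem_abelian abAB).
have [p_pr _ [k defn]] := pgroup_pdiv (abelem_pgroup abAB) ntAB.
have := cycAB; rewrite (abelem_cyclic abAB) -card_quotient ?normal_norm //=.
rewrite defn pfactorK //.
by case: k defn.
Qed.

(** The inequality says that A maximizes the product #|B| * #|'C_V(B)| among its
subgroups B that contain 'C_A(V), a property of abelian subgroups of maximal
order.  If A did not centralize Q, take B of index p as in abelem_cent_index; on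
V1 = 'C_V(B) the group A has a fixed subgroup of index at most p, so two
conjugates A and A :^ g generate a group that fixes a subgroup of index at most
p ^ 2.  Its p'-part Y in Q then acts faithfully on [~: V1, Y], of order at most
p ^ 2, against coprime_plane. *)
Lemma offender_cent gT (p : nat) (A Q V : {group gT}) :
    prime p -> odd p -> p.-group A -> p^'.-group Q -> p.-group V ->
    abelian Q -> abelian V -> A \subset 'N(Q) -> A \subset 'N(V) ->
    Q \subset 'N(V) -> 'C_Q(V) = 1 -> p.-abelem (A / 'C_A(V)) ->
    (forall B : {group gT}, 'C_A(V) \subset B -> B \subset A ->
       #|B| * #|'C_V(B)| <= #|A| * #|'C_V(A)|) ->
  A \subset 'C(Q).
Proof.
move=> p_pr odd_p pA p'Q pV abQ abV nQA nVA nVQ CQV abAC maxA.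
apply: contraT => ncQA.
have coQA : coprime #|Q| #|A| by rewrite coprime_sym (pnat_coprime pA p'Q).
have nsCA : 'C_A(V) <| A by rewrite /normal subsetIl normsI ?normG ?norms_cent.
have cQC : 'C_A(V) \subset 'C(Q).
  apply/commG1P/trivgP; rewrite -CQV subsetI.
  rewrite commg_subr subIset ?nQA //=.
  rewrite (subset_trans (commgSS (subsetIr _ _) (subxx _))) //.
  by rewrite commg_subl norms_cent.
have [B [sCB nsBA iAB ncQ1]] :=
  abelem_cent_index abQ nQA coQA nsCA abAC cQC ncQA.
have sBA := normal_sub nsBA; have pB := pgroupS sBA pA.
pose Q1 := 'C_Q(B)%G; pose V1 := 'C_V(B)%G; pose Q0 := [~: Q1, A]%G.
have sQ1Q : Q1 \subset Q := subsetIl _ _.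
have nBA := normal_norm nsBA.
have nQ1A : A \subset 'N(Q1) by rewrite normsI ?norms_cent.
have sQ01 : Q0 \subset Q1 by rewrite commg_subl.
have sQ0Q := subset_trans sQ01 sQ1Q.
have nQ0A : A \subset 'N(Q0) := commg_normr A Q1.
have CQ0A : 'C_Q0(A) = 1.
  apply: coprime_abel_cent_TI => //.
    exact: coprimeSg coQA.
  exact: abelianS abQ.
have nV1A : A \subset 'N(V1) by rewrite normsI ?norms_cent.
have cBQ0 : Q0 \subset 'C(B) by rewrite (subset_trans sQ01) ?subsetIr.
have nVQ0 := subset_trans sQ0Q nVQ.
have nV1Q0 : Q0 \subset 'N(V1) by rewrite normsI // norms_cent // cents_norm.
have sV1V : V1 \subset V := subsetIl _ _.
have CQ0V1 : 'C_Q0(V1) = 1.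
  have sCQ0 : 'C_Q0(V1) \subset Q0 := subsetIl _ _.
  have sCQ := subset_trans sCQ0 sQ0Q.
  apply/trivgP; rewrite -CQV subsetI sCQ /=.
  apply: (cent_cent_pgroup pB pV abV (pgroupS sCQ p'Q)).
  - exact: subset_trans sBA nVA.
  - exact: subset_trans sCQ nVQ.
  - exact: subset_trans sCQ0 cBQ0.
  exact: subsetIr.
pose K := 'C_V1(A)%G.
have leV1 : #|V1| <= p * #|K|.
  have := maxA B sCB sBA; rewrite -(Lagrange sBA) iAB -mulnA leq_pmul2l //.
  by rewrite /= -setIA (setIidPr (centS sBA)).
have ntQ0 : Q0 :!=: 1 by rewrite -(sameP commG1P eqP) centsC.
have [g Q0g ntg] := trivgPn _ ntQ0.
have [a Aa ntag] := commg_neq1_exists Q0g ntg CQ0A.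
pose X := (A <*> A :^ g)%G; pose Y := (X :&: Q0)%G.
have sYQ0 : Y \subset Q0 := subsetIr _ _.
have Yag : [~ a, g] \in Y.
  apply/setIP; split; last first.
    by rewrite commgEr groupM // memJ_norm ?groupV // (subsetP nQ0A).
  by rewrite commgEl groupM ?groupV // mem_gen // inE ?Aa ?memJ_conjg ?Aa ?orbT.
have nYA : A \subset 'N(Y).
  by rewrite normsI // (subset_trans _ (normG _)) ?joing_subl.
have CYA : 'C_Y(A) = 1 by apply/trivgP; rewrite -CQ0A setSI.
have nV1Y := subset_trans sYQ0 nV1Q0.
have pV1 := pgroupS sV1V pV.
have p'Y : p^'.-group Y := pgroupS (subset_trans sYQ0 sQ0Q) p'Q.
have coV1Y : coprime #|V1| #|Y| := pnat_coprime pV1 p'Y.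
have abV1 := abelianS sV1V abV.
pose W := [~: V1, Y]%G; pose Z := 'C_V1(Y)%G.
have defV1 : W * Z = V1 := coprime_comm_mul_cent nV1Y coV1Y (abelian_sol abV1).
have sWV1 : W \subset V1 by rewrite commg_subl.
have tiWZ : W :&: Z = 1.
  by rewrite setIA (setIidPl sWV1) (coprime_abel_cent_TI nV1Y).
have leW : #|W| <= p ^ 2.
  have sKV1 : K \subset V1 := subsetIl _ _.
  have sKgV1 : K :^ g \subset V1 by rewrite -(normsP nV1Q0 g Q0g) conjSg.
  have sKKZ : K :&: K :^ g \subset Z.
    rewrite subsetI subIset ?sKV1 //= centsC (subset_trans (subsetIl _ _)) //.
    rewrite gen_subG subUset centsC (subset_trans (subsetIl _ _)) ?subsetIr //=.
    rewrite centsC (subset_trans (subsetIr _ _)) // conjIg subIset //.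
    by rewrite centJ subxx orbT.
  have := subset_leq_card (mul_subG sKV1 sKgV1).
  have := mul_cardG K (K :^ g); rewrite cardJg => defKK leKK.
  have leZ := subset_leq_card sKKZ.
  have cWZ := TI_cardMg tiWZ; rewrite defV1 in cWZ.
  have Z_gt0 := cardG_gt0 Z.
  rewrite -(leq_pmul2r Z_gt0) -cWZ -(leq_pmul2l (cardG_gt0 V1)).
  apply: leq_trans (leq_mul leV1 leV1) _.
  rewrite mulnACA mulnn defKK mulnCA leq_mul //; exact: leq_mul.
have CYW : 'C_Y(W) = 1.
  have: W * Z \subset 'C('C_Y(W)).
    rewrite mul_subG //; first by rewrite centsC; apply: subsetIr.
    by rewrite (subset_trans (subsetIr _ _)) // centS ?subsetIl.
  rewrite defV1 centsC => cV1; apply/trivgP; rewrite -CQ0V1 subsetI cV1.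
  by rewrite (subset_trans (subsetIl _ _) sYQ0).
have Y1 : Y :=: 1.
  apply: (coprime_plane p_pr odd_p pA p'Y (pgroupS sWV1 pV1)) => //.
    exact: normsR.
  exact: commg_normr.
by case/negP: ntag; apply/eqP/set1gP; rewrite -Y1.
Qed.
End Offender.

(** * The Thompson subgroup *)

(** Among the variants of the Thompson subgroup, this one uses elementary abelian
subgroups of maximal rank instead of abelian subgroups of maximal order, so that
the groups induced on V below are elementary abelian. *)
Definition thompsonJ (p : nat) (gT : finGroupType) (A : {set gT}) : {set gT} :=
  <<\bigcup_(E in 'E_p^('r_p(A))(A)) gval E>>.

Canonical thompsonJ_group p gT A := Eval hnf in [group of @thompsonJ p gT A].

Section ThompsonJ.

Variable p : nat.
Implicit Types gT : finGroupType.

Lemma thompsonJ_sub gT (P : {group gT}) : thompsonJ p P \subset P.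
Proof.
by rewrite gen_subG; apply/bigcupsP=> E /pnElemP[].
Qed.

Lemma thompsonJ_char gT (P : {group gT}) : thompsonJ p P \char P.
Proof.
apply/charP; split=> [|f injf fP]; first exact: thompsonJ_sub.
apply/eqP; rewrite eqEcard card_injm ?thompsonJ_sub // leqnn andbT.
have sEP E : E \in 'E_p^('r_p(P))(P) -> E \subset P by case/pnElemP.
rewrite morphim_gen ?gen_subG; last by apply/bigcupsP.
apply/subsetP=> _ /morphimP[x _ /bigcupP[E EE Ex] ->].
apply/mem_gen/bigcupP; exists (f @* E)%G; last first.
  by rewrite mem_morphim ?(subsetP (sEP E EE)).
by have := injm_pnElem injf (subxx P) p 'r_p(P) (sEP E EE); rewrite fP EE => ->.
Qed.

(** Containing J forces U to have the same maximal elementary abelian subgroups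
as P.  This is what makes J normal in a group that normalizes U. *)
Lemma thompsonJ_eq gT (P U : {group gT}) :
  U \subset P -> thompsonJ p P \subset U -> thompsonJ p P = thompsonJ p U.
Proof.
move=> sUP sJU.
have sEU E : E \in 'E_p^('r_p(P))(P) -> E \subset U.
  by move=> EE; apply: subset_trans sJU; apply/sub_gen/bigcup_sup.
have rUP : 'r_p(U) = 'r_p(P).
  apply/eqP; rewrite eqn_leq p_rankS //=; have [E EE] := p_rank_witness p P.
  have [_ abE <-] := pnElemP EE; rewrite -(p_rank_abelem abE).
  exact: p_rankS (sEU E EE).
rewrite /thompsonJ rUP; congr <<_>>; apply: eq_bigl => E.
apply/idP/idP=> [EE | ]; last exact: (subsetP (pnElemS _ _ sUP)).
by have [_ abE dE] := pnElemP EE; apply/pnElemP; rewrite sEU.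
Qed.

Lemma thompsonJ_neq1 gT (P : {group gT}) :
  p.-group P -> P :!=: 1 -> thompsonJ p P != 1.
Proof.
move=> pP ntP; have [E EE] := p_rank_witness p P.
have sEJ : E \subset thompsonJ p P by apply/sub_gen/bigcup_sup.
have [_ _ dE] := pnElemP EE; apply: contraTneq sEJ => ->; rewrite subG1.
apply/eqP=> E1; have [p_pr p_dv _] := pgroup_pdiv pP ntP.
have : 0 < 'r_p(P) by rewrite p_rank_gt0 mem_primes p_pr p_dv cardG_gt0.
by rewrite -dE E1 cards1 logn1.
Qed.

(** For F = E :&: (U <*> B), which acts on V as B does, the product
F * 'C_V(F) is elementary abelian, hence no larger than E; this bounds
#|F| * #|'C_V(F)| by #|E| * #|'C_V(E)|, since the intersections with V are
fixed by E.  The indices of B in A and of F in E agree. *)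
Lemma max_abelem_offender gT (P U V E A B : {group gT}) :
    prime p -> p.-group P -> U \subset P -> P \subset 'N(U) -> V \subset U ->
    U \subset 'C(V) -> p.-abelem V -> E \in 'E_p^('r_p(P))(P) ->
    A \subset P -> U * A = U * E -> U :&: A = 'C_A(V) ->
    'C_A(V) \subset B -> B \subset A ->
  #|B| * #|'C_V(B)| <= #|A| * #|'C_V(A)|.
Proof.
move=> p_pr pP sUP nUP sVU cVU abV EE sAP eUA UA_C sCB sBA.
have [sEP abE dE] := pnElemP EE.
have nUE := subset_trans sEP nUP; have nUA := subset_trans sAP nUP.
have nUB := subset_trans sBA nUA.
have cVUmul (X Y : {group gT}) : U * X = U * Y -> 'C_V(X) \subset 'C_V(Y).
  move=> eqUXY; rewrite subsetI subsetIl /= centsC.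
  apply: subset_trans (mulG_subr U Y) _; rewrite -eqUXY mul_subG //.
    by rewrite (subset_trans cVU) // centS ?subsetIl.
  by rewrite centsC subsetIr.
pose F := (E :&: (U <*> B))%G.
have defUB : U <*> B = U * B by rewrite norm_joinEr.
have sUBE : U * B \subset U * E by rewrite -eUA mulgS.
have eUF : U * F = U * B.
  by rewrite /= group_modl ?joing_subl //= defUB (setIidPr sUBE).
have eqCF : 'C_V(F) = 'C_V(B) by apply/eqP; rewrite eqEsubset !cVUmul.
have eqCE : 'C_V(E) = 'C_V(A) by apply/eqP; rewrite eqEsubset !cVUmul.
have sFE : F \subset E := subsetIl _ _.
have leFE : #|F| * #|'C_V(F)| <= #|E| * #|'C_V(E)|.
  have abFC : p.-abelem (F <*> 'C_V(F)).
    have cFC : F \subset 'C('C_V(F)) by rewrite centsC subsetIr.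
    rewrite (cprod_abelem p (cprodEY _)) ?(abelemS sFE) //; last by rewrite centsC.
    by rewrite (abelemS _ abV) ?subsetIl.
  have sFCP : F <*> 'C_V(F) \subset P.
    rewrite join_subG (subset_trans sFE) //= (subset_trans (subsetIl _ _)) //.
    exact: subset_trans sUP.
  have leFC : #|F <*> 'C_V(F)| <= #|E|.
    have pE := abelem_pgroup abE; have pFC := abelem_pgroup abFC.
    rewrite (card_pgroup pE) (card_pgroup pFC) dE leq_pexp2l ?prime_gt0 //.
    by rewrite -(p_rank_abelem abFC) p_rankS.
  rewrite mul_cardG -cent_joinEr ?subsetIr //.
  apply: leq_mul leFC (subset_leq_card _).
  rewrite subsetI (subset_trans (subsetIr _ _)) ?subsetIl //=.
  rewrite (subset_trans (subsetIl _ _)) // (subset_trans sFE) //.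
  exact: abelem_abelian abE.
have eqUF : U :&: F = U :&: E.
  rewrite setIA; apply/setIidPl.
  by rewrite (subset_trans (subsetIl _ _)) ?joing_subl.
have eqUB : U :&: B = U :&: A.
  by apply/eqP; rewrite eqEsubset setIS //= subsetI subsetIl UA_C.
have cU := cardG_gt0 U; have cUE := cardG_gt0 (U :&: E)%G.
rewrite -(leq_pmul2l cU) !mulnA (mul_cardG U B) (mul_cardG U A) eqUB.
rewrite -2![(_ * #|U :&: A| * _)%N]mulnAC leq_pmul2r ?cardG_gt0 //.
rewrite eUA -eUF -(leq_pmul2r cUE) mulnAC [leqRHS]mulnAC /=.
rewrite -[X in _ <= X * _]mul_cardG -eqUF -mul_cardG -!mulnA leq_pmul2l //.
by rewrite -eqCF -eqCE.
Qed.

(** A subgroup E of P that is elementary abelian of maximal rank acts on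
V = 'Ohm_1('Z('O_p(G))) like a subgroup A of P1, to which offender_cent applies.
So A centralizes Q; but 'O_p(G) <*> 'C_P1(Q) is a normal p-subgroup of G.  The
hypothesis on 'Ohm_1('Z(P)) ensures that G / 'O_p(G) acts faithfully on V. *)
Lemma thompsonJ_sub_pcore gT (G P P1 Q : {group gT}) :
    prime p -> odd p -> p.-Sylow(G) P -> 'O_p(G) * P1 = P ->
    P1 \subset 'N(Q) -> Q \subset G -> p^'.-group Q -> abelian Q ->
    G \subset 'O_p(G) <*> Q <*> P1 -> 'C_G('O_p(G)) \subset 'O_p(G) ->
    p.-group 'N_G('Ohm_1('Z(P))) ->
  thompsonJ p P \subset 'O_p(G).
Proof.
set U := 'O_p(G)%G => p_pr odd_p sylP defP nQP1 sQG p'Q abQ sGUQP1 cUsub pNZP.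
have [sPG pP _] := and3P sylP; have sUP : U \subset P := pcore_sub_Hall sylP.
have nsUG : U <| G := pcore_normal p G; have pU : p.-group U := pcore_pgroup p G.
have [sUG nUG] := andP nsUG; have sP1P : P1 \subset P by rewrite -defP mulG_subr.
have pP1 := pgroupS sP1P pP; have sP1G := subset_trans sP1P sPG.
have nUQ := subset_trans sQG nUG.
have tiUQ : U :&: Q = 1 := coprime_TIg (pnat_coprime pU p'Q).
have genG (H : {group gT}) :
    U \subset H -> Q \subset H -> P1 \subset H -> G \subset H.
  move=> sUH sQH sP1H; apply: subset_trans sGUQP1 _.
  by rewrite !join_subG sUH sQH.
have pU_Z : p.-group 'Z(U) := pgroupS (center_sub U) pU.
pose V := 'Ohm_1('Z(U))%G; set ZP := 'Ohm_1('Z(P)) in pNZP.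
have abV : p.-abelem V by rewrite Ohm1_abelem ?center_abelian.
have nsVG : V <| G by do 2!apply: gFnormal_trans.
have sVZ : V \subset 'Z(U) := Ohm_sub 1 _.
have sVU : V \subset U := subset_trans sVZ (center_sub U).
have cVU : U \subset 'C(V) by rewrite centsC (subset_trans sVZ) // subsetIr.
have sZPV : ZP \subset V.
  apply: OhmS; have sZU : 'Z(P) \subset U.
    apply: subset_trans cUsub; rewrite subsetI subIset ?sPG //=.
    by rewrite (subset_trans (subsetIr _ _)) // centS.
  by rewrite subsetI sZU (subset_trans (subsetIr _ _)) // centS.
have cVsub : 'C_G(V) \subset U.
  apply: pcore_max.
    by apply: pgroupS pNZP; rewrite setIS // (subset_trans (centS sZPV)) ?cent_sub.
  by rewrite /normal subsetIl normsI ?normG ?norms_cent ?normal_norm.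
have CQV : 'C_Q(V) = 1.
  apply/trivgP; rewrite -tiUQ subsetI subsetIl andbT.
  by apply: subset_trans cVsub; rewrite setSI.
have cP1Q : 'C_P1(Q) \subset U.
  pose T := (U <*> 'C_P1(Q))%G; have sCP1 : 'C_P1(Q) \subset P1 := subsetIl _ _.
  have nUC := subset_trans sCP1 (subset_trans sP1G nUG).
  apply: subset_trans (joing_subr U _) _; apply: pcore_max.
    by rewrite /= norm_joinEr // pgroupM pU (pgroupS sCP1).
  apply/andP; split; first by rewrite join_subG sUG (subset_trans sCP1).
  apply: genG.
  - by rewrite (subset_trans _ (normG _)) ?joing_subl.
  - by rewrite normsY // cents_norm // centsC subsetIr.
  rewrite normsY //; first exact: subset_trans nUG.
  by rewrite normsI ?normG ?norms_cent.
rewrite gen_subG; apply/bigcupsP=> E EE; have [sEP abE _] := pnElemP EE.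
have nUP := subset_trans sPG nUG; have nUE := subset_trans sEP nUP.
pose A := (P1 :&: (U <*> E))%G; have sAP1 : A \subset P1 := subsetIl _ _.
have sAP := subset_trans sAP1 sP1P; have nUA := subset_trans sAP nUP.
have pA := pgroupS sAP pP.
have defUA : U * A = U * E.
  rewrite /= group_modl ?joing_subl // defP /= norm_joinEr //.
  by apply/setIidPr; rewrite mul_subG.
have UA_C : U :&: A = 'C_A(V).
  have sCU : 'C_A(V) \subset U.
    by apply: subset_trans cVsub; rewrite setSI ?(subset_trans sAP).
  apply/eqP; rewrite eqEsubset [U :&: A]setIC setIS //=.
  by rewrite subsetI subsetIl.
have cAQ : A \subset 'C(Q).
  apply: (offender_cent p_pr odd_p pA p'Q (abelem_pgroup abV)) => //.
  - exact: abelem_abelian abV.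
  - exact: subset_trans sAP1 nQP1.
  - exact: subset_trans sAP (subset_trans sPG (normal_norm nsVG)).
  - exact: subset_trans sQG (normal_norm nsVG).
  - rewrite -UA_C (isog_abelem (second_isog nUA)).
    have eqAU : A / U = E / U.
      by rewrite -(quotientMidl U E) -defUA quotientMidl.
    by rewrite /= eqAU quotient_abelem.
  move=> B sCB sBA.
  exact: (max_abelem_offender p_pr pP sUP nUP sVU cVU abV EE sAP defUA).
have sAU : A \subset U by rewrite (subset_trans _ cP1Q) // subsetI sAP1.
by rewrite (subset_trans (mulG_subr U E)) // -defUA mul_subG.
Qed.

End ThompsonJ.

(** * Thompson's normal p-complement theorem *)

(** Stated for all Sylow p-subgroups, which are conjugate, so that the condition
restricts to subgroups of G containing one of them. *)
Definition char_local_pnilpotent (p : nat) (gT : finGroupType) (G : {group gT}) :=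
  forall P X : {group gT}, p.-Sylow(G) P -> X \char P -> X :!=: 1 ->
  pnilpotent p 'N_G(X).

Section Thompson.

Variable p : nat.
Implicit Types gT : finGroupType.

Lemma char_local_pnilpotentS gT (G H P : {group gT}) :
    p.-Sylow(G) P -> P \subset H -> H \subset G ->
  char_local_pnilpotent p G -> char_local_pnilpotent p H.
Proof.
move=> sylP sPH sHG locG P1 X sylP1 chX ntX.
have sylPH : p.-Sylow(H) P := pHall_subl sPH sHG sylP.
have sylP1G : p.-Sylow(G) P1.
  rewrite pHallE (subset_trans (pHall_sub sylP1)) //=.
  by rewrite (card_Hall sylP1) -(card_Hall sylPH) (card_Hall sylP).
by apply: pnilpotentS (locG P1 X sylP1G chX ntX); rewrite setSI.
Qed.

(** P is isomorphic to P / K, so a characteristic subgroup X' of P / K lifts to one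
of P, X; the Frattini argument in X <*> K lifts the normalizer. *)
Lemma char_local_pnilpotent_quo_p' gT (G K : {group gT}) :
    K <| G -> p^'.-group K -> char_local_pnilpotent p G ->
  char_local_pnilpotent p (G / K).
Proof.
move=> nsKG p'K locG P' X' sylP' chX' ntX'; have nKG := normal_norm nsKG.
have [P sylP defP'] := quotient_Sylow_lift nsKG sylP'.
rewrite defP' in chX'; have [sPG pP _] := and3P sylP.
have nKP := subset_trans sPG nKG.
have tiPK : P :&: K = 1 := coprime_TIg (pnat_coprime pP p'K).
pose f := restrm_morphism nKP (coset_morphism K).
have injf : 'injm f by rewrite ker_restrm ker_coset tiPK.
have imfP : f @* P = P / K by rewrite morphim_restrm setIid.
have sX'P : X' \subset f @* P by rewrite imfP char_sub.
pose X := (invm injf @* X')%G.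
have chX : X \char P.
  have chX'f : X' \char f @* P by rewrite imfP.
  have := injm_char (injm_invm injf) (subxx _) chX'f.
  by rewrite (morphim_invm injf (subxx P)).
have sXP := char_sub chX.
have defX' : X / K = X'.
  have -> : X / K = f @* X by rewrite morphim_restrm (setIidPr sXP).
  by rewrite /= morphim_invmE morphpreK.
have ntX : X :!=: 1 by apply: contraNneq ntX' => X1; rewrite -defX' X1 quotient1.
clearbody X; have pNX := locG P X sylP chX ntX.
have nKX := subset_trans sXP nKP.
have nsKY : K <| X <*> K.
  apply/andP; split; first exact: joing_subr.
  by rewrite join_subG nKX normG.
have defXK : (X <*> K) / K = X' by rewrite quotientYidr.
have sYG : X <*> K \subset G by rewrite join_subG (subset_trans sXP sPG) normal_sub.
have sylX : p.-Sylow(X <*> K) X.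
  rewrite pHallE joing_subl /= norm_joinEl // TI_cardMg; last first.
    by apply/trivgP; rewrite -tiPK setSI.
  have pX : p.-nat #|X| := pgroupS sXP pP.
  by rewrite partnM ?cardG_gt0 // part_pnat_id // part_p'nat ?muln1.
have nsYN : X <*> K <| 'N_G(X <*> K) by rewrite normalSG.
have sNN : 'N_(G / K)(X') \subset 'N_G(X) / K.
  rewrite -defXK -quotient_subnormG // -(Frattini_arg nsYN sylX) /=.
  rewrite norm_joinEl // (normC nKX) -mulgA quotientMidl.
  rewrite quotientS // mul_subG ?setSI ?subsetIl //.
  by rewrite subsetI (subset_trans sXP sPG) normG.
exact: pnilpotentS sNN (pnilpotent_quo K pNX).
Qed.

Lemma char_local_pnilpotent_norm gT (G P X : {group gT}) :
    (forall H : {group gT}, H \proper G ->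
       char_local_pnilpotent p H -> pnilpotent p H) ->
    char_local_pnilpotent p G -> p.-Sylow(G) P -> P \subset 'N(X) ->
    ~~ (G \subset 'N(X)) ->
  pnilpotent p 'N_G(X).
Proof.
move=> IHG locG sylP nXP nnXG; have sPG := pHall_sub sylP.
apply: IHG; first by rewrite properE subsetIl subsetI subxx.
by apply: char_local_pnilpotentS sylP _ _ locG; rewrite ?subsetIl // subsetI sPG.
Qed.

(** By Frobenius some nontrivial p-subgroup U has a normalizer N that is not
p-nilpotent; choose U to maximize the p-part of #|N|.  Characteristic subgroups
of a Sylow p-subgroup S of N have normalizers with a larger p-part, unless S is
Sylow in G, so N inherits the hypothesis.  Hence N is not proper in G. *)
Lemma char_local_pnilpotent_pcore_neq1 gT (G : {group gT}) :
    (forall H : {group gT}, H \proper G ->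
       char_local_pnilpotent p H -> pnilpotent p H) ->
    char_local_pnilpotent p G -> ~~ pnilpotent p G -> 'O_p(G) != 1.
Proof.
move=> IHG locG npG; apply: contra npG => /eqP Op1.
apply: Frobenius_normal_p_complement.
pose bad (U : {group gT}) :=
  [&& U \subset G, p.-group U, U :!=: 1 & ~~ pnilpotent p 'N_G(U)].
have [U0 bad0 | nobad] := pickP bad; last first.
  by move=> U sUG pU ntU; have:= nobad U; rewrite /bad sUG pU ntU => /negbFE.
case: (arg_maxnP (fun U : {group gT} => (#|'N_G(U)|`_p)%N) bad0) => U.
case/and4P=> sUG pU ntU npU maxU.
have prN : 'N_G(U) \proper G.
  rewrite properE subsetIl /= subsetI subxx /=; apply: contra ntU => nUG.
  by rewrite -subG1 -Op1 pcore_max // /normal sUG.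
exfalso; case/negP: npU; apply: IHG => // S X sylS chX ntX.
have [sSN pS _] := and3P sylS.
have sSG := subset_trans sSN (subsetIl _ _).
apply: contraT => npX; have {}npX : ~~ pnilpotent p 'N_G(X).
  by apply: contra npX; apply: pnilpotentS; rewrite setSI ?subsetIl.
have sXG := subset_trans (char_sub chX) sSG.
have badX : bad X by rewrite /bad sXG (pgroupS (char_sub chX) pS) ntX.
have : (#|'N_G(X)|`_p <= #|'N_G(U)|`_p)%N := maxU X badX.
rewrite -(card_Hall sylS) leqNgt => /negP[].
have [P sylP sSP] := Sylow_superset sSG pS.
have [eqSP | neqSP] := eqVneq S P.
  by case/negP: npX; apply: locG sylP _ ntX; rewrite -eqSP.
have prS : S \proper P by rewrite properEneq neqSP.
have pP := pHall_pgroup sylP.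
have prSN := nilpotent_proper_norm (pgroup_nil pP) prS.
apply: leq_trans (proper_card prSN) _.
have sNP : 'N_P(S) \subset 'N_G(X).
  rewrite subsetI (subset_trans (subsetIl _ _) (pHall_sub sylP)).
  by rewrite (char_norm_trans chX) ?subsetIr.
rewrite -(part_pnat_id (pgroupS (subsetIl P 'N(S)) pP)).
by rewrite dvdn_leq ?part_gt0 // partn_dvd ?cardG_gt0 ?cardSg.
Qed.

(** A nontrivial characteristic subgroup of a Sylow subgroup of G / 'O_p(G) lifts
to a p-subgroup larger than 'O_p(G), whose normalizer is therefore proper in G
and p-nilpotent by the assumption on proper subgroups. *)
Lemma char_local_pnilpotent_quo_pcore gT (G : {group gT}) :
    (forall H : {group gT}, H \proper G ->
       char_local_pnilpotent p H -> pnilpotent p H) ->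
    char_local_pnilpotent p G -> char_local_pnilpotent p (G / 'O_p(G)).
Proof.
move=> IHG locG S X' sylS chX' ntX'; have nsUG := pcore_normal p G.
have [P sylP defS] := quotient_Sylow_lift nsUG sylS.
have nsX'S := char_normal chX'.
have sUP : 'O_p(G) \subset P := pcore_sub_Hall sylP.
have nsUP : 'O_p(G) <| P := normalS sUP (pHall_sub sylP) nsUG.
rewrite defS in nsX'S; have [X defX' sUX nsXP] := inv_quotientN nsUP nsX'S.
have nsUX : 'O_p(G) <| X := normalS sUX (normal_sub nsXP) nsUP.
have nnXG : ~~ (G \subset 'N(X)).
  apply: contra ntX' => nXG; rewrite defX' -subG1 quotient_sub1 ?normal_norm //.
  rewrite pcore_max ?(pgroupS (normal_sub nsXP) (pHall_pgroup sylP)) //.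
  by rewrite /normal (subset_trans (normal_sub nsXP)) ?(pHall_sub sylP).
have pN := char_local_pnilpotent_norm IHG locG sylP (normal_norm nsXP) nnXG.
have -> : 'N_(G / 'O_p(G))(X') = 'N_G(X) / 'O_p(G).
  by rewrite defX' -quotient_subnormG.
exact: pnilpotent_quo.
Qed.

(** In 'C_K('O_p(G)) the Sylow p-subgroup is central, so it has a normal
complement, which lies in 'O_p^'(G) = 1. *)
Lemma pcore_cent_sub gT (G K : {group gT}) :
    'O_p^'(G) = 1 -> K <| G -> 'O_p(G) \subset K ->
    p^'.-group (K / 'O_p(G)) -> p.-group (G / K) ->
  'C_G('O_p(G)) \subset 'O_p(G).
Proof.
set U := 'O_p(G)%G => Op'1 nsKG sUK p'KU pGK; have [sKG nKG] := andP nsKG.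
have nsUG : U <| G := pcore_normal p G; have pU : p.-group U := pcore_pgroup p G.
have nsCG : 'C_G(U) <| G.
  by rewrite /normal subsetIl normsI ?normG ?norms_cent ?normal_norm.
pose C := 'C_K(U)%G; pose Z := (U :&: C)%G.
have nsCKG : C <| G.
  by rewrite /normal subIset ?sKG //= normsI ?norms_cent ?normal_norm.
have nsZC : Z <| C.
  by rewrite /normal subsetIr normsI ?normG ?cents_norm ?subsetIr.
have p'CZ : p^'.-group (C / Z).
  have nUC : C \subset 'N(U) by rewrite cents_norm ?subsetIr.
  rewrite (isog_pgroup _ (second_isog nUC)).
  by apply: pgroupS p'KU; rewrite quotientS ?subsetIl.
have hallZ : Hall C Z.
  rewrite /Hall normal_sub //= (pnat_coprime (pgroupS (subsetIl _ _) pU)) //.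
  by rewrite -card_quotient ?normal_norm.
have /splitsP[L /complP[tiZL defC]] := SchurZassenhaus_split hallZ nsZC.
have sLC : L \subset C by rewrite -defC mulG_subr.
have nsLC : L <| C.
  rewrite /normal sLC -defC mul_subG ?normG // cents_norm //.
  rewrite centsC (subset_trans sLC) // (subset_trans (subsetIr _ _)) //.
  by rewrite centS ?subsetIl.
have p'L : p^'.-group L.
  have isoL : L \isog C / Z.
    rewrite -defC quotientMidl quotient_isog ?(subset_trans sLC) //.
    exact: normal_norm.
  by rewrite (isog_pgroup _ isoL).
have L1 : L :=: 1.
  apply/trivgP; rewrite -Op'1 (subset_trans (pcore_max p'L nsLC)) //.
  by rewrite pcore_max ?pcore_pgroup // gFnormal_trans.
have sCU : C \subset U by rewrite -defC L1 mulg1 subsetIl.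
rewrite pcore_max // /pgroup -(LagrangeI 'C_G(U) K) pnatM; apply/andP; split.
  apply: pgroupS pU; apply: subset_trans sCU; rewrite subsetI subsetIr.
  by rewrite subIset // subsetIr.
have nKC := subset_trans (normal_sub nsCG) nKG.
rewrite -card_quotient //.
by apply: pgroupS pGK; rewrite quotientS ?normal_sub.
Qed.

(** The normalizer of the complement Q covers G / U by the Frattini argument based
on the conjugacy of complements. *)
Lemma normal_Hall_Frattini_Sylow gT (G K U : {group gT}) :
    U <| G -> p.-group U -> U \subset K -> K <| G -> p^'.-group (K / U) ->
  exists Q P1 P : {group gT},
    [/\ U * Q = K, p^'.-group Q, P1 \subset 'N(Q), p.-Sylow(G) P & U * P1 = P].
Proof.
move=> nsUG pU sUK nsKG p'KU; have [sUG nUG] := andP nsUG.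
have [sKG nKG] := andP nsKG; have nsUK : U <| K := normalS sUK sKG nsUG.
have hallU : Hall K U.
  rewrite /Hall normal_sub //= (pnat_coprime pU) //.
  by rewrite -card_quotient ?normal_norm.
have /splitsP[Q /complP[tiUQ defUQ]] := SchurZassenhaus_split hallU nsUK.
have sQK : Q \subset K by rewrite -defUQ mulG_subr.
have sQG := subset_trans sQK sKG; have nUQ := subset_trans sQG nUG.
have p'Q : p^'.-group Q.
  have isoQ : Q \isog K / U by rewrite -defUQ quotientMidl quotient_isog.
  by rewrite (isog_pgroup _ isoQ).
have coUQ : coprime #|U| #|Q| := pnat_coprime pU p'Q.
have defG : U * 'N_G(Q) = G.
  apply/eqP; rewrite eqEsubset mul_subG ?subsetIl //=; apply/subsetP=> g Gg.
  have sQgUQ : Q :^ g \subset U * Q by rewrite defUQ -(normsP nKG g Gg) conjSg.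
  have [x Ux defQg] := SchurZassenhaus_trans_sol (pgroup_sol pU) nUQ sQgUQ coUQ
    (cardJg Q g).
  rewrite -(normC (subset_trans (subsetIl G 'N(Q)) nUG)).
  have Gx := subsetP sUG x Ux; apply/mulsgP; exists (g * x^-1) x; rewrite ?mulgKV //.
  by rewrite !inE groupM ?groupV //= conjsgM defQg conjsgK.
have [P1 sylP1] := Sylow_exists p 'N_G(Q).
have [sP1N pP1 _] := and3P sylP1; have [sP1G nQP1] := subsetIP sP1N.
have [P sylP sP1P] := Sylow_superset sP1G pP1; have [sPG pP _] := and3P sylP.
have sUP : U \subset P.
  by rewrite (subset_trans (pcore_max pU nsUG)) ?pcore_sub_Hall.
have defP : U * P1 = P.
  have -> : P1 :=: P :&: 'N_G(Q).
    have pPN : p.-group (P :&: 'N_G(Q)) := pgroupS (subsetIl _ _) pP.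
    apply/eqP; rewrite eqEsubset subsetI sP1P sP1N /=.
    by rewrite (sub_pHall sylP1 pPN) ?subsetIr // subsetI sP1P.
  by rewrite setIC group_modl // defG (setIidPr sPG).
by exists Q, P1, P.
Qed.

(** In a minimal counterexample 'O_p^'(G) = 1, while U = 'O_p(G) <> 1 and G / U is
p-nilpotent, so G = U * Q * P1 with Q a p'-group normalized by P1.  The proper
subgroups containing P = U * P1 are p-nilpotent, hence p-groups as U is
self-centralizing; thus P1 acts irreducibly on Q, and Q is abelian.  Then
thompsonJ_sub_pcore makes the Thompson subgroup of P normal in G. *)
Theorem Thompson_normal_p_complement gT (G : {group gT}) :
  prime p -> odd p -> char_local_pnilpotent p G -> pnilpotent p G.
Proof.
move=> p_pr odd_p; have [n] := ubnP #|G|.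
elim: n => // n IHn in gT G *; rewrite ltnS => leGn locG.
have IHG (H : {group gT}) :
    H \proper G -> char_local_pnilpotent p H -> pnilpotent p H.
  by move=> prH; apply: IHn; apply: leq_trans (proper_card prH) leGn.
apply: contraT => npG.
have Op'1 : 'O_p^'(G) = 1.
  apply/eqP; apply: contraR npG => ntO.
  apply: (@pnilpotent_quo_p' p _ _ 'O_p^'(G)%G);
    rewrite ?pcore_normal ?pcore_pgroup //.
  apply: IHn; first by apply: leq_trans leGn; rewrite ltn_quotient ?pcore_sub.
  by apply: char_local_pnilpotent_quo_p'; rewrite ?pcore_normal ?pcore_pgroup.
pose U := 'O_p(G)%G.
have ntU : U :!=: 1 := char_local_pnilpotent_pcore_neq1 IHG locG npG.
have nsUG : U <| G := pcore_normal p G; have pU : p.-group U := pcore_pgroup p G.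
have [sUG nUG] := andP nsUG.
have pGU : pnilpotent p (G / U).
  apply: IHn; first by apply: leq_trans leGn; rewrite ltn_quotient ?pcore_sub.
  exact: char_local_pnilpotent_quo_pcore.
have [K defK sUK nsKG] := inv_quotientN nsUG (pcore_normal p^' (G / U)).
have p'KU : p^'.-group (K / U) by rewrite -defK pcore_pgroup.
have pGK : p.-group (G / K).
  by rewrite -(isog_pgroup _ (third_isog sUK nsUG nsKG)) -defK.
have [sKG nKG] := andP nsKG.
have cUsub : 'C_G(U) \subset U := pcore_cent_sub Op'1 nsKG sUK p'KU pGK.
(* 'O_p^'(H) centralizes U, so it lies in U and is trivial. *)
have pOver (H : {group gT}) :
    U \subset H -> H \subset G -> pnilpotent p H -> p.-group H.
  move=> sUH sHG pH; apply: pnilpotent_p'core1 pH _; apply/trivgP.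
  have sOU : 'O_p^'(H) \subset U.
    apply: subset_trans cUsub; rewrite subsetI (subset_trans (pcore_sub _ _)) //.
    exact: p'core_cent_pgroup (normalS sUH sHG nsUG) pU.
  rewrite -(coprime_TIg (pnat_coprime pU (pcore_pgroup p^' H))) subsetI sOU /=.
  exact: subxx.
have [Q [P1 [P [defUQ p'Q nQP1 sylP defP]]]] :=
  normal_Hall_Frattini_Sylow nsUG pU sUK nsKG p'KU.
have [sPG pP _] := and3P sylP; have sUP : U \subset P := pcore_sub_Hall sylP.
have sP1P : P1 \subset P by rewrite -defP mulG_subr.
have pP1 := pgroupS sP1P pP; have sP1G := subset_trans sP1P sPG.
have sQG : Q \subset G by rewrite (subset_trans _ sKG) // -defUQ mulG_subr.
have nUQ := subset_trans sQG nUG.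
have tiUQ : U :&: Q = 1 := coprime_TIg (pnat_coprime pU p'Q).
have ntP : P :!=: 1 by apply: contraNneq ntU => P_1; rewrite -subG1 -P_1.
have defKP : K * P = G := normal_pquo_mul_Sylow nsKG pGK sylP.
have genG (H : {group gT}) :
    U \subset H -> Q \subset H -> P1 \subset H -> G \subset H.
  by move=> sUH sQH sP1H; rewrite -defKP -defUQ -defP !mul_subG.
(* For such an R, P <*> R is G or a proper subgroup, to which pOver applies. *)
have Qirr (R : {group gT}) : R \subset Q -> P1 \subset 'N(R) -> R :=: 1 \/ R :=: Q.
  move=> sRQ nRP1; have sRG := subset_trans sRQ sQG.
  have nUR := subset_trans sRG nUG.
  have sHG : P <*> R \subset G by rewrite join_subG sPG.
  have [eqHG | neqHG] := eqVneq (P <*> R) G; [right | left].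
    have nURR : R \subset 'N(U <*> R).
      by rewrite (subset_trans _ (normG _)) ?joing_subr.
    have nURU : U \subset 'N(U <*> R).
      by rewrite (subset_trans _ (normG _)) ?joing_subl.
    have nURP1 : P1 \subset 'N(U <*> R).
      by rewrite normsY // (subset_trans sP1G).
    have nURP : P \subset 'N(U <*> R) by rewrite -defP mul_subG.
    have nsURG : U <*> R <| G.
      apply/andP; split; first by rewrite join_subG sUG.
      by rewrite -eqHG join_subG nURP.
    have pGUR : p.-group (G / (U <*> R)).
      have sRUR : R / (U <*> R) = 1 by apply: quotientS1; apply: joing_subr.
      by rewrite -eqHG quotientY // sRUR joingG1 quotient_pgroup.
    have sQUR : Q \subset U <*> R.
      have nURQ := subset_trans sQG (normal_norm nsURG).
      have coGQ := pnat_coprime pGUR (quotient_pgroup (U <*> R) p'Q).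
      rewrite -quotient_sub1 //= -(coprime_TIg coGQ).
      by rewrite subsetI subxx quotientS.
    apply/eqP; rewrite eqEsubset sRQ /=.
    have := setIidPl sQUR; rewrite norm_joinEr // -group_modr // (setIC Q).
    by rewrite tiUQ mul1g => ->; apply: subxx.
  have prH : (P <*> R)%G \proper G by rewrite properEneq neqHG.
  have sUH : U \subset (P <*> R)%G by rewrite (subset_trans sUP) ?joing_subl.
  have pH : p.-group (P <*> R).
    apply: pOver => //; apply: IHG => //.
    by apply: char_local_pnilpotentS sylP _ sHG locG; apply: joing_subl.
  have pR : p.-group R by apply: pgroupS pH; apply: joing_subr.
  have p'R := pgroupS sRQ p'Q.
  by apply/trivgP; rewrite -(coprime_TIg (pnat_coprime pR p'R)) setIid.
have ntQ : Q :!=: 1.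
  apply: contraNneq npG => Q1; apply: pnilpotent_pgroup.
  rewrite (pgroupS (genG P _ _ _)) //; last by rewrite Q1 sub1G.
(* Apply Qirr to a P1-invariant Sylow subgroup of Q, then to Q^`(1). *)
have abQ : abelian Q.
  have coQP1 : coprime #|Q| #|P1| by rewrite coprime_sym (pnat_coprime pP1 p'Q).
  have [q q_pr q_dv] : exists2 q, prime q & q %| #|Q|.
    by exists (pdiv #|Q|); rewrite ?pdiv_dvd ?pdiv_prime ?cardG_gt1.
  have [R sylR nRP1] := sol_coprime_Sylow_exists q (pgroup_sol pP1) nQP1 coQP1.
  have pQ : q.-group Q.
    case: (Qirr R (pHall_sub sylR) nRP1) => [R1 | <-]; last exact: pHall_pgroup sylR.
    have := card_Hall sylR; rewrite R1 cards1 => /esym/eqP.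
    by rewrite partG_eq1 /pgroup p'natE // q_dv.
  have nQ'P1 : P1 \subset 'N(Q^`(1)) by apply: char_norm_trans nQP1; apply: der_char.
  case: (Qirr Q^`(1)%G (der_sub 1 Q) nQ'P1) => [Q'1 | eqQ'].
    by apply/derG1P.
  have := sol_der1_proper (pgroup_sol pQ) (subxx Q) ntQ.
  by rewrite eqQ' properxx.
have pNZP : p.-group 'N_G('Ohm_1('Z(P))).
  have chZP : 'Ohm_1('Z(P)) \char P by do 2!apply: gFchar_trans.
  apply: pOver; rewrite ?subsetIl //.
    by rewrite subsetI sUG (subset_trans sUP) ?char_norm.
  apply: locG sylP chZP _.
  by rewrite Ohm1_eq1 center_nil_eq1 ?(pgroup_nil pP).
have sJU : thompsonJ p P \subset U.
  apply: (thompsonJ_sub_pcore p_pr odd_p sylP defP nQP1 sQG p'Q abQ _ cUsub pNZP).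
  apply: (genG (U <*> Q <*> P1)%G); rewrite ?joing_subr //.
    by rewrite (subset_trans (joing_subl U Q)) ?joing_subl.
  by rewrite (subset_trans (joing_subr U Q)) ?joing_subl.
have chJ := thompsonJ_char p P; have ntJ := thompsonJ_neq1 pP ntP.
case/negP: npG; have := locG P _ sylP chJ ntJ.
have nsJG : thompsonJ p P <| G.
  rewrite (thompsonJ_eq sUP sJU); exact: char_normal_trans (thompsonJ_char p U) nsUG.
by rewrite (setIidPl (normal_norm nsJG)).
Qed.

End Thompson.

(** * Nilpotent maximal subgroups *)

Section NilpotentMaximal.

Implicit Types gT : finGroupType.

(** A perfect subgroup has trivial image in a solvable group. *)
Lemma perfect_sub_normal gT (G H N : {group gT}) :
    H \subset [~: H, H] -> H \subset G -> N <| G -> solvable (G / N) ->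
  H \subset N.
Proof.
move=> perfH sHG nsNG solGN; have nNH := subset_trans sHG (normal_norm nsNG).
rewrite -quotient_sub1 // subG1; apply: (implyP (forallP solGN (H / N)%G)).
by rewrite /= subsetI quotientS //= -quotientR ?quotientS.
Qed.

Lemma nilpotent_normal_Sylow gT (G : {group gT}) :
  (forall P : {group gT}, Sylow G P -> P <| G) -> nilpotent G.
Proof.
move=> nsP; rewrite (_ : gval G = 'F(G)) ?Fitting_nil //.
apply/eqP; rewrite eqEsubset Fitting_sub andbT -{1}(Sylow_gen G) gen_subG.
apply/bigcupsP=> P sylP; have [p _ sylpP] := SylowP _ _ sylP.
exact: Fitting_max (nsP P sylP) (pgroup_nil (pHall_pgroup sylpP)).
Qed.

Lemma solvable_odd_Sylow_Fitting gT (H : {group gT}) :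
    (forall p (P : {group gT}), prime p -> odd p -> p.-Sylow(H) P ->
       P \subset 'F(H)) ->
  solvable H.
Proof.
move=> sF; have nsFH := Fitting_normal H.
rewrite (series_sol nsFH) (nilpotent_sol (Fitting_nil H)) /=.
apply: (@pgroup_sol _ 2); apply/pgroupP=> q q_pr q_dv.
case: (even_prime q_pr) => [-> // | odd_q].
have [S sylS] := Sylow_exists q H.
have nFS := subset_trans (pHall_sub sylS) (normal_norm nsFH).
have := quotient_pHall nFS sylS.
rewrite (quotientS1 (sF q S _ _ _)) // => /card_Hall/esym/eqP.
by rewrite cards1 partG_eq1 /pgroup p'natE // q_dv.
Qed.

Lemma Sylow_sub_Fitting gT (p : nat) (G H S : {group gT}) :
  p.-Sylow(G) 'O_p(G) -> H \subset G -> p.-Sylow(H) S -> S \subset 'F(H).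
Proof.
move=> sylO sHG sylS; have [sSH pS _] := and3P sylS.
have sSO : S \subset 'O_p(G) by rewrite (sub_Hall_pcore sylO) ?(subset_trans sSH).
apply: (@subset_trans _ _ ('O_p(G) :&: H)); first by rewrite subsetI sSO.
apply: Fitting_max.
  by rewrite /normal subsetIr normsI ?normG // (subset_trans sHG) ?gFnorm.
by apply: (@pgroup_nil _ p); apply: pgroupS (subsetIl _ _) (pcore_pgroup _ _).
Qed.

(** M normalizes Q, hence every subgroup X of Q that contains 'O_p(G) and is
characteristic modulo it; by maximality 'N_G(X) is M or G, and in the last case
X is 'O_p(G). *)
Lemma nilpotent_max_char_locals gT (p : nat) (G : {group gT}) :
    (forall Q : {group gT}, p.-Sylow(G) Q ->
       exists M : {group gT}, [/\ maximal M G, nilpotent M & Q \subset M]) ->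
  char_local_pnilpotent p (G / 'O_p(G)).
Proof.
move=> maxQ S X' sylS chX' ntX'; have nsUG := pcore_normal p G.
have [Q sylQ defS] := quotient_Sylow_lift nsUG sylS.
have [M [maxM nilM sQM]] := maxQ Q sylQ; have sMG := proper_sub (maxgroupp maxM).
have sUQ : 'O_p(G) \subset Q := pcore_sub_Hall sylQ.
have nsUM : 'O_p(G) <| M := normalS (subset_trans sUQ sQM) sMG nsUG.
have nsUQ : 'O_p(G) <| Q := normalS sUQ (pHall_sub sylQ) nsUG.
have nsQM : Q <| M.
  by rewrite (nilpotent_Hall_pcore nilM (pHall_subl sQM sMG sylQ)) pcore_normal.
have pX' : p.-group X' := pgroupS (char_sub chX') (pHall_pgroup sylS).
rewrite defS in chX'.
have nsX'M := char_normal_trans chX' (quotient_normal 'O_p(G) nsQM).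
have [X defX' sUX nsXM] := inv_quotientN nsUM nsX'M.
have sXM := normal_sub nsXM; have nsUX := normalS sUX sXM nsUM.
have pX : p.-group X.
  by rewrite -(pquotient_pgroup (pcore_pgroup p G) (normal_norm nsUX)) -defX'.
have -> : 'N_(G / 'O_p(G))(X') = 'N_G(X) / 'O_p(G).
  by rewrite defX' -quotient_subnormG.
apply: pnilpotent_quo; have sXG := subset_trans sXM sMG.
have sMN : M \subset 'N_G(X) by rewrite subsetI sMG normal_norm.
have [_ maxMG] := maxgroupP maxM.
have [eqNG | neqNG] := eqVneq 'N_G(X) G.
  case/eqP: ntX'; rewrite defX' quotientS1 // pcore_max //.
  by rewrite /normal sXG -eqNG subsetIr.
have /= -> := maxMG 'N_G(X)%G _ sMN; first exact: nilpotent_pnilpotent.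
by rewrite properEneq neqNG subsetIl.
Qed.

End NilpotentMaximal.

(** * The intersection of the non-nilpotent maximal subgroups *)

Section Core.

Variables (gT : finGroupType) (G : {group gT}).
Local Notation core := (nonnil_max_Sylow_normalizer_core G).

Lemma core_norm : G \subset 'N(core).
Proof.
apply/subsetP=> g Gg; rewrite inE; apply/subsetP=> _ /imsetP[x Dx ->].
have [Gx /bigcapP sDx] := setIP Dx; rewrite inE groupJ //=.
apply/bigcapP=> M /and3P[maxM nilM /existsP[P /andP[/hasP[p p_G sylP] sNM]]].
rewrite -mem_conjgV; apply: (sDx (M :^ g^-1)%G); apply/and3P; split.
- by rewrite -(conjGid (groupVr Gg)) maximalJ.
- by rewrite -(isog_nil (conj_isog M g^-1)).
apply/existsP; exists (P :^ g^-1)%G; apply/andP; split.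
  by apply/hasP; exists p; rewrite // pHallJ ?groupV.
by rewrite -{1}(conjGid (groupVr Gg)) normJ -conjIg conjSg.
Qed.

Lemma core_group_set : group_set core.
Proof. exact: groupP (G :&: \bigcap_(M : {group gT} | _) M)%G. Qed.

Let D := Group core_group_set.

Lemma core_normal : D <| G.
Proof. by rewrite /normal subsetIl core_norm. Qed.

(** If M were not nilpotent it would contain D, as it contains the normalizer of a
Sylow subgroup Q of G with D :&: Q = P; but D and 'N_G(P) generate G. *)
Lemma core_Sylow_nilpotent_max (p : nat) (P : {group gT}) :
    prime p -> p.-Sylow(D) P -> ~~ (P <| D) ->
  exists M : {group gT}, [/\ maximal M G, nilpotent M & 'N_G(P) \subset M].
Proof.
move=> p_pr sylP nnP; have [sDG nDG] := andP core_normal.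
have [sPD pP _] := and3P sylP; have sPG := subset_trans sPD sDG.
have [M maxM sNM] : exists2 M : {group gT}, maximal M G & 'N_G(P) \subset M.
  have [NG | [M maxM sNM]] := maximal_exists (subsetIl G 'N(P)); last by exists M.
  case/negP: nnP; rewrite /normal sPD (subset_trans sDG) //.
  by rewrite -NG subsetIr.
exists M; split=> //; apply: contraT => nilM.
have [Q sylQ sPQ] := Sylow_superset sPG pP.
have defP : D :&: Q = P.
  apply/eqP; rewrite eq_sym eqEcard subsetI sPD sPQ (card_Hall sylP).
  by rewrite (card_Hall (Sylow_setI_normal core_normal sylQ)) /=.
have sDM : D \subset M.
  rewrite subIset // orbC (bigcap_inf M) // maxM nilM /=.
  apply/existsP; exists Q; apply/andP; split.
    apply/hasP; exists p => //; rewrite mem_primes p_pr cardG_gt0 /=.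
    have ntP : P :!=: 1 by apply: contraNneq nnP => ->; apply: normal1.
    have [_ p_dv _] := pgroup_pdiv pP ntP.
    exact: dvdn_trans p_dv (cardSg sPG).
  apply: subset_trans sNM; rewrite subsetI subsetIl -defP normsI ?subsetIr //.
  by rewrite (subset_trans (subsetIl _ _)).
have [_ /negP[]] := andP (maxgroupp maxM).
by rewrite -(Frattini_arg core_normal sylP) mul_subG.
Qed.

(** A nontrivial perfect subgroup H of G would be solvable: its Sylow subgroups for
odd primes are normal, by the case distinction on the Sylow subgroups of D. *)
Lemma core_nilpotent : ~~ solvable G -> nilpotent core.
Proof.
move=> nsolG; apply: contraT => nnilD; have nsDG := core_normal.
have [H sHG [perfH ntH]] : exists2 H : {group gT}, H \subset G &
    H \subset [~: H, H] /\ H :!=: 1.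
  move: nsolG; rewrite negb_forall_in => /exists_inP[H].
  by rewrite subsetI => /andP[sHG perfH] ntH; exists H.
have [p0 [P0 [p0_pr sylP0 nnP0]]] : exists p (P : {group gT}),
    [/\ prime p, p.-Sylow(D) P & ~~ (P <| D)].
  have: ~~ [forall (P : {group gT} | Sylow D P), P <| D].
    by apply: contra nnilD => /forall_inP nsP; apply: nilpotent_normal_Sylow nsP.
  rewrite negb_forall_in => /exists_inP[P /SylowP[p p_pr sylP] nnP].
  by exists p, P.
have sHD : H \subset D.
  have [M [maxM nilM sNM]] := core_Sylow_nilpotent_max p0_pr sylP0 nnP0.
  apply: (perfect_sub_normal perfH sHG nsDG); apply: nilpotent_sol.
  have -> : (G / D)%G = ('N_G(P0) / D)%G.
    apply: val_inj; rewrite /= -[X in X / _](Frattini_arg nsDG sylP0).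
    by rewrite quotientMidl.
  by apply: quotient_nil; apply: nilpotentS sNM nilM.
suff solH : solvable H.
  case/eqP: ntH; apply/eqP; apply: (implyP (forallP solH H)).
  by rewrite subsetI subxx.
apply: solvable_odd_Sylow_Fitting => p S p_pr odd_p sylS.
have [P sylP] := Sylow_exists p D.
have [nsPD | nnP] := boolP (P <| D).
  by apply: (@Sylow_sub_Fitting _ p D); rewrite ?(normal_Hall_pcore sylP).
(* All Sylow p-subgroups of D fail to be normal, since they are conjugate. *)
have pGU : pnilpotent p (G / 'O_p(G)).
  apply: Thompson_normal_p_complement => //.
  apply: nilpotent_max_char_locals => Q sylQ.
  have sylPQ := Sylow_setI_normal nsDG sylQ.
  have nnPQ : ~~ ((D :&: Q)%G <| D).
    apply: contra nnP => nsQD.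
    have [x Dx ->] := Sylow_trans sylPQ sylP.
    by rewrite /= (normsP (normal_norm nsQD)).
  have [M [maxM nilM sNM]] := core_Sylow_nilpotent_max p_pr sylPQ nnPQ.
  exists M; split=> //; apply: subset_trans sNM.
  rewrite subsetI (pHall_sub sylQ) normsI ?normG //.
  exact: subset_trans (pHall_sub sylQ) (normal_norm nsDG).
have nsUG := pcore_normal p G.
have [K defK sUK nsKG] := inv_quotientN nsUG (pcore_normal p^' (G / 'O_p(G))).
apply: (@Sylow_sub_Fitting _ p K) => //.
  have nsUK := normalS sUK (normal_sub nsKG) nsUG.
  have sylU : p.-Sylow(K) 'O_p(G).
    apply/and3P; split; [exact: normal_sub | exact: pcore_pgroup |].
    have p'KU : p^'.-group (K / 'O_p(G)) by rewrite -defK pcore_pgroup.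
    by rewrite -card_quotient ?normal_norm.
  by rewrite (normal_Hall_pcore sylU).
apply: (perfect_sub_normal perfH sHG nsKG); apply: (@pgroup_sol _ p).
by rewrite -(isog_pgroup _ (third_isog sUK nsUG nsKG)) -defK.
Qed.

End Core.

Theorem theorem1p2 (gT : finGroupType) (G : {group gT})
    (nsolG : ~~ solvable G) :
  nilpotent (nonnil_max_Sylow_normalizer_core G).
Proof. exact: core_nilpotent. Qed.
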